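(* There is a polynomial-time algorithm that solves CFFA on instances in which the conflict graph $\mathcal{H}$ is a cluster graph consisting of $2$ cliques and the utility functions are uniform, i.e., $u_a=u_{a'}$ for all agents $a,a'$.
   Context: CFFA: the input is a finite set of agents $\mathcal{A}$, a finite set of jobs $\mathcal{I}$, for each agent $a\in\mathcal{A}$ a utility function $u_a\colon\mathcal{I}\to\mathbb{N}$, a positive integer $\eta$, and a graph $\mathcal{H}$ with vertex set $\mathcal{I}$. The question is whether there is $\phi\colon\mathcal{A}\to 2^{\mathcal{I}}$ such that each $\phi(a)$ is an independent set in $\mathcal{H}$ with $\sum_{x\in\phi(a)}u_a(x)\ge\eta$, and the sets $\phi(a)$, $a\in\mathcal{A}$, are pairwise disjoint. A cluster graph is a disjoint union of cliques. *)

(* Defs.v *)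
From mathcomp Require Import all_boot.

Set Implicit Arguments.
Unset Strict Implicit.
Unset Printing Implicit Defensive.

(** * Random access machines with the logarithmic cost criterion *)

(* Registers R_0, R_1, ... hold arbitrary natural numbers; the input is a
   read-only sequence of natural numbers consumed from left to right.  There is
   no multiplication, and every instruction is charged the bit lengths of the
   register indices and register contents that it handles; polynomial time on
   this machine is therefore polynomial time on Turing machines with the numbers
   written in binary. *)
Inductive instr : Type :=
  | Const of nat & nat          (* Const i v   : R_i := v *)
  | Add of nat & nat & nat      (* Add i j k   : R_i := R_j + R_k *)
  | Sub of nat & nat & nat      (* Sub i j k   : R_i := max(R_j - R_k, 0) *)
  | LoadFrom of nat & nat       (* LoadFrom i j : R_i := R_(R_j) *)
  | StoreTo of nat & nat        (* StoreTo i j : R_(R_i) := R_j *)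
  | Read of nat                 (* Read i      : R_i := next input, 0 if none *)
  | JumpPos of nat & nat        (* JumpPos j l : if R_j > 0 then goto l *)
  | Halt of bool.               (* Halt b      : stop and answer b *)

Definition program := seq instr.

Record config : Type := Config { pc : nat; mem : nat -> nat; inp : seq nat }.

Definition init (w : seq nat) : config := Config 0 (fun=> 0) w.

Definition write (R : nat -> nat) (i v : nat) : nat -> nat :=
  fun k => if k == i then v else R k.

(* There is no successor after [Halt] nor when the program counter lies outside
   the program; in the second case the machine is stuck and gives no answer. *)
Definition step (P : program) (c : config) : option config :=
  let: Config l R w := c in
  match onth P l with
  | Some (Const i v) => Some (Config l.+1 (write R i v) w)
  | Some (Add i j k) => Some (Config l.+1 (write R i (R j + R k)) w)
  | Some (Sub i j k) => Some (Config l.+1 (write R i (R j - R k)) w)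
  | Some (LoadFrom i j) => Some (Config l.+1 (write R i (R (R j))) w)
  | Some (StoreTo i j) => Some (Config l.+1 (write R (R i) (R j)) w)
  | Some (Read i) => Some (Config l.+1 (write R i (head 0 w)) (behead w))
  | Some (JumpPos j l') => Some (Config (if 0 < R j then l' else l.+1) R w)
  | Some (Halt _) | None => None
  end.

(* Length of the binary representation of [n], with [bitlen 0 = 1]. *)
Definition bitlen (n : nat) : nat := (trunc_log 2 n).+1.

Definition cost (P : program) (c : config) : nat :=
  let: Config l R w := c in
  match onth P l with
  | Some (Const i v) => bitlen i + bitlen v
  | Some (Add i j k) | Some (Sub i j k) =>
      bitlen i + (bitlen j + bitlen (R j)) + (bitlen k + bitlen (R k))
  | Some (LoadFrom i j) =>
      bitlen i + (bitlen j + bitlen (R j) + bitlen (R (R j)))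
  | Some (StoreTo i j) => bitlen i + bitlen (R i) + (bitlen j + bitlen (R j))
  | Some (Read i) => bitlen i + bitlen (head 0 w)
  | Some (JumpPos j _) => bitlen j + bitlen (R j)
  | Some (Halt _) | None => 1
  end.

(* [halts P c b t]: from [c], the program stops with answer [b] at total
   cost [t]. *)
Inductive halts (P : program) : config -> bool -> nat -> Prop :=
  | halts_now c b : onth P (pc c) = Some (Halt b) -> halts P c b (cost P c)
  | halts_later c c' b t :
      step P c = Some c' -> halts P c' b t -> halts P c b (cost P c + t).

Definition input_size (w : seq nat) : nat := \sum_(v <- w) bitlen v.

(* One program answers the question [Q] correctly, in time polynomial in the
   size of the encoded input, on all inputs satisfying the promise [D]. *)
Definition poly_time_solvable_on (X : Type) (enc : X -> seq nat)
    (D Q : X -> Prop) : Prop :=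
  exists (P : program) (c d : nat), forall x : X, D x ->
    exists (b : bool) (t : nat),
      [/\ halts P (init (enc x)) b t,
          t <= c * input_size (enc x) ^ d + c
        & b <-> Q x].

(** * Conflict-free fair allocation *)

Definition independent (V : finType) (E : rel V) (S : {set V}) : Prop :=
  forall x y, x \in S -> y \in S -> ~~ E x y.

(* The parts of a partition are nonempty, so there are exactly [k] cliques. *)
Definition cluster_graph_of (k : nat) (V : finType) (E : rel V) : Prop :=
  exists C : {set {set V}},
    [/\ partition C [set: V], #|C| = k
      & forall x y, E x y <-> x != y /\ exists2 B, B \in C & x \in B /\ y \in B].

(* The finite sets of agents and jobs are numbered from 0. *)
Record CFFA_instance : Type := CFFAInstance {
  agents : nat;
  jobs : nat;
  utility : 'I_agents -> 'I_jobs -> nat;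
  eta : nat;
  conflict : rel 'I_jobs;
  eta_gt0 : 0 < eta;
  conflict_sym : symmetric conflict;
  conflict_irr : irreflexive conflict
}.

Definition CFFA (I : CFFA_instance) : Prop :=
  exists phi : 'I_(agents I) -> {set 'I_(jobs I)},
    [/\ forall a, independent (@conflict I) (phi a),
        forall a, eta I <= \sum_(x in phi a) utility a x
      & forall a a', a != a' -> [disjoint phi a & phi a']].

Definition uniform_utilities (I : CFFA_instance) : Prop :=
  forall a a' : 'I_(agents I), utility a =1 utility a'.

(* Utility table and adjacency matrix are listed row by row. *)
Definition encode_CFFA (I : CFFA_instance) : seq nat :=
  [:: agents I; jobs I; eta I]
  ++ [seq utility a x | a <- enum 'I_(agents I), x <- enum 'I_(jobs I)]
  ++ [seq nat_of_bool (conflict x y)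
       | x <- enum 'I_(jobs I), y <- enum 'I_(jobs I)].

(* Main.v *)
Require Import Defs.
From mathcomp Require Import all_boot zify.

(* A bundle contains at most one job of each clique.  A job of utility at least
   eta serves an agent on its own, and it is never useful to add a second job to
   it.  Among the remaining jobs a bundle is a pair of jobs of different cliques
   with utilities summing to at least eta.  Take any job x and pair it with the
   lightest job y of the other clique that completes it, or discard x if there is
   none; an exchange argument shows that this greedy choice is optimal for any
   order of the jobs x.

   A step of the machine at most doubles the largest number in memory, so a
   polynomial bound on the number of steps alone bounds the logarithmic cost. *)

Set Implicit Arguments.
Unset Strict Implicit.
Unset Printing Implicit Defensive.

(** * Greedy allocation *)

(** Agents with equal utilities are interchangeable, so only their number [r] matters. *)
Definition feasible (V : finType) (E : rel V) (h : nat) (w : V -> nat) (r : nat) : Prop :=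
  exists phi : 'I_r -> {set V},
    [/\ forall a, independent E (phi a),
        forall a, h <= \sum_(x in phi a) w x
      & forall a b x, x \in phi a -> x \in phi b -> a = b].

(** A used job keeps its vertex and loses its utility, so the graph stays fixed, as in the machine's
    table. *)
Definition zero_on (V : finType) (S : {set V}) (w : V -> nat) (x : V) : nat :=
  if x \in S then 0 else w x.

Section Feasible.

Variables (V : finType) (E : rel V) (h : nat).
Implicit Types (S T : {set V}) (w : V -> nat) (r : nat).

Lemma independentS S T : S \subset T -> independent E T -> independent E S.
Proof. by move=> /subsetP sST iT x y /sST xT /sST; apply: iT. Qed.

Lemma sum_zero_on S T w : \sum_(x in T) zero_on S w x = \sum_(x in T :\: S) w x.
Proof.
rewrite (eq_bigl (fun x => (x \in T) && (x \notin S)) w) => [|x].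
  by rewrite big_mkcondr; apply: eq_bigr => x _; rewrite /zero_on; case: (x \in S).
by rewrite inE andbC.
Qed.

Lemma sum_zero_on_disjoint S T w : [disjoint T & S] ->
  \sum_(x in T) zero_on S w x = \sum_(x in T) w x.
Proof. by move=> dTS; rewrite sum_zero_on; move/setDidPl: dTS => ->. Qed.

Lemma feasible0 w : feasible E h w 0.
Proof. by exists (fun=> set0); split=> -[]. Qed.

Lemma feasible_gt0 w r : 0 < h -> (forall x, w x = 0) ->
  feasible E h w r <-> r = 0.
Proof.
move=> h0 w0; split=> [[phi [_ hphi _]]|->]; last exact: feasible0.
case: r phi hphi => // r phi /(_ ord0); rewrite big1 //; lia.
Qed.

(** The first agent takes [S]; the others give up its jobs, which are worth nothing under
    [zero_on S w]. The truncated [r.-1] matches the machine's subtraction. *)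
Lemma feasible_add S r w :
    independent E S -> h <= \sum_(x in S) w x ->
  feasible E h (zero_on S w) r.-1 -> feasible E h w r.
Proof.
move=> iS hS; case: r => [_|r [phi [ind hphi inj]]]; first exact: feasible0.
exists (fun a => if unlift ord0 a is Some b then phi b :\: S else S).
split=> [a|a|a b x].
- case: unliftP => [b _|_] //; apply: independentS (ind b); exact: subsetDl.
- by case: unliftP => [b _|_] //; rewrite -sum_zero_on.
case: unliftP => [a' ->|->]; case: unliftP => [b' ->|->] //; rewrite ?inE.
- by move=> /andP[_ xa] /andP[_ xb]; rewrite (inj _ _ _ xa xb).
- by move=> /andP[/negP].
- by move=> + /andP[/negP].
Qed.

Lemma feasible_zero_on S r w :
  feasible E h (zero_on S w) r -> feasible E h w r.
Proof.
move=> [phi [ind hphi inj]]; exists phi; split=> // a.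
apply: leq_trans (hphi a) _; apply: leq_sum => x _.
by rewrite /zero_on; case: ifP.
Qed.

Lemma feasible_pick x r (phi : 'I_r.+1 -> {set V}) :
    (forall a b y, y \in phi a -> y \in phi b -> a = b) ->
  exists a, forall b, x \in phi b -> a = b.
Proof.
move=> inj; have [a xa|no] := pickP (fun a => x \in phi a).
  by exists a => b; apply: inj.
by exists ord0 => b; rewrite no.
Qed.

Lemma feasible_big x r w : irreflexive E -> h <= w x ->
  feasible E h w r <-> feasible E h (zero_on [set x] w) r.-1.
Proof.
move=> irr hx; split; last first.
  apply: feasible_add; last by rewrite big_set1.
  by move=> y z /set1P-> /set1P->; rewrite irr.
case: r => [_|r [phi [ind hphi inj]]]; first exact: feasible0.
have [a ha] := feasible_pick x inj.
exists (fun c => phi (lift a c)); split=> // [c|c d y yc yd].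
- rewrite sum_zero_on_disjoint // disjoints_subset; apply/subsetP => y yc.
  rewrite !inE; apply: contraTneq yc => ->; apply/negP => /ha /eqP.
  by rewrite (negbTE (neq_lift _ _)).
- by apply: (@lift_inj _ a); apply: inj yc yd.
Qed.

Variable side : V -> bool.
Hypothesis side_conflict : forall x y, E x y = (x != y) && (side x == side y).

(** Of three distinct jobs, two lie on the same side. *)
Lemma independent_other S x y z : independent E S ->
  x \in S -> y \in S :\ x -> z \in S :\ x -> y = z.
Proof.
move=> iS xS /setD1P[yx yS] /setD1P[zx zS]; apply/eqP.
have := iS _ _ xS yS; have := iS _ _ xS zS; have := iS _ _ yS zS.
rewrite !side_conflict (eq_sym x y) (eq_sym x z) yx zx.
by case: eqP => // _; case: (side x) (side y) (side z) => -[] [].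
Qed.

Lemma sum_partner S w x : independent E S -> x \in S -> w x < h ->
    h <= \sum_(y in S) w y ->
  exists y, [/\ S :\ x = [set y], ~~ E x y & h <= w x + w y].
Proof.
move=> iS xS wx; rewrite (big_setD1 x xS) /= => hS.
have [S0|[y yS]] := set_0Vmem (S :\ x).
  by move: hS; rewrite S0 big_set0; lia.
have Sy : S :\ x = [set y].
  apply/setP => z; rewrite in_set1; apply/idP/eqP => [zS|-> //].
  exact: independent_other zS yS.
exists y; split=> //; first by apply: iS => //; case/setD1P: yS.
by move: hS; rewrite Sy big_set1.
Qed.

Lemma feasible_unmatched x r w :
    w x < h -> (forall y, y != x -> ~~ E x y -> w x + w y < h) ->
  feasible E h w r <-> feasible E h (zero_on [set x] w) r.
Proof.
move=> wx no; split; last exact: feasible_zero_on.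
move=> [phi [ind hphi inj]]; exists phi; split=> // a.
rewrite sum_zero_on_disjoint // disjoint_sym disjoints1; apply/negP => xa.
have [y [Sy Exy hy]] := sum_partner (ind a) xa wx (hphi a).
have : y \in phi a :\ x by rewrite Sy set11.
by case/setD1P => /no /(_ Exy); rewrite ltnNge hy.
Qed.

(* If an allocation has bundles {x, y'} and {x', y}, then w y <= w y' by
   minimality of y, so {x', y'} is still heavy enough and x, y can be paired. *)
Lemma feasible_matched x y r w :
    w x < h -> y != x -> ~~ E x y -> h <= w x + w y ->
    (forall z, z != x -> ~~ E x z -> h <= w x + w z -> w y <= w z) ->
  feasible E h w r <-> feasible E h (zero_on [set x; y] w) r.-1.
Proof.
move=> wx yx Exy hxy min_y; split; last first.
  apply: feasible_add; last by rewrite big_setU1 ?big_set1 // inE eq_sym.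
  have irr z : ~~ E z z by rewrite side_conflict eqxx.
  have Eyx : ~~ E y x by rewrite side_conflict eq_sym (eq_sym (side y)) -side_conflict.
  by move=> u v /set2P[] -> /set2P[] ->.
case: r => [_|r [phi [ind hphi inj]]]; first exact: feasible0.
have [a [xa ya]] : exists a, (forall b, x \in phi b -> a = b) /\
    (forall b, y \in phi b -> b != a -> x \in phi a).
  have [a xa|nox] := pickP (fun a => x \in phi a).
    by exists a; split=> // b; apply: inj.
  have [a ya] := feasible_pick y inj.
  by exists a; split=> [b|b /ya ->]; rewrite ?nox ?eqxx.
have xl c : x \notin phi (lift a c).
  by apply/negP => /xa /eqP; rewrite (negbTE (neq_lift _ _)).
(* In the bundle that loses [y], the former partner of [x] takes its place. *)
pose F c := if y \in phi (lift a c) then (phi (lift a c) :\ y) :|: (phi a :\ x)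
            else phi (lift a c).
have inF c z : z \in F c ->
    z \in phi (lift a c) \/ z \in phi a /\ y \in phi (lift a c).
  rewrite /F; case: ifP => yc; last by left.
  by rewrite !inE => /orP[] /andP[_]; auto.
have heq c : y \in phi (lift a c) -> exists2 z, phi a :\ x = [set z] &
    [/\ z != x, ~~ E x z & w y <= w z].
  move=> yc; have xpa : x \in phi a.
    by apply: ya yc _; rewrite eq_sym neq_lift.
  have [z [Sz Exz hz]] := sum_partner (ind a) xpa wx (hphi a).
  have : z \in phi a :\ x by rewrite Sz set11.
  by case/setD1P => zx _; exists z => //; split=> //; apply: min_y.
have yF c : y \notin F c.
  rewrite /F; case: ifP => [yc|->//]; rewrite !inE eqxx yx /=.
  by apply/negP => /inj /(_ yc) /eqP; rewrite (negbTE (neq_lift _ _)).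
have xF c : x \notin F c.
  rewrite /F; case: ifP => [yc|_]; last exact: xl.
  by rewrite !inE eqxx (negbTE (xl c)) andbF.
exists F; split.
- move=> c u v; rewrite /F; case: ifP => [yc|_]; last exact: ind.
  have [z Sz [zx Exz _]] := heq c yc; rewrite Sz.
  (* Both [y] and [z] lie on the side opposite to [x], and the other jobs of the bundle avoid the
     side of [y]. *)
  have sidez t : t \in phi (lift a c) :\ y -> side t != side z.
    case/setD1P => ty tc; have := ind _ _ _ tc yc.
    move: Exy Exz; rewrite !side_conflict ty eq_sym yx (eq_sym x z) zx.
    by case: (side x) (side y) (side z) (side t) => -[] [] [].
  case/setUP => [uc|/set1P->]; case/setUP => [vc|/set1P->].
  + by case/setD1P: uc => _ uc; case/setD1P: vc => _ vc; apply: ind uc vc.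
  + by rewrite side_conflict (negbTE (sidez _ uc)) andbF.
  + by rewrite side_conflict eq_sym (eq_sym (side z)) (negbTE (sidez _ vc)) andbF.
  + by rewrite side_conflict eqxx.
- move=> c; rewrite sum_zero_on_disjoint; last first.
    rewrite disjoint_sym disjoints_subset; apply/subsetP => u /set2P[] ->;
    by rewrite inE ?xF ?yF.
  rewrite /F; case: ifP => [yc|_]; last exact: hphi.
  have [z Sz [zx Exz wz]] := heq c yc; rewrite Sz setUC big_setU1 /=.
    apply: leq_trans (hphi (lift a c)) _.
    by rewrite (big_setD1 y yc) leq_add2r.
  have : z \in phi a :\ x by rewrite Sz set11.
  case/setD1P => _ za; rewrite !inE negb_and; apply/orP; right.
  by apply/negP => /(inj _ _ _ za) /eqP; rewrite (negbTE (neq_lift _ _)).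
move=> c d u /inF uc /inF ud; apply: (@lift_inj _ a).
case: uc ud => [uc|[uc yc]] [ud|[ud yd]].
- exact: inj uc ud.
- by move/eqP: (inj _ _ _ ud uc); rewrite (negbTE (neq_lift _ _)).
- by move/eqP: (inj _ _ _ uc ud); rewrite (negbTE (neq_lift _ _)).
- exact: inj yc yd.
Qed.

End Feasible.

(** The side of a job is its membership in one of the two cliques. Nonemptiness matters because the
    machine's loops test only at their end. *)
Lemma cluster2_side (V : finType) (E : rel V) : cluster_graph_of 2 E ->
  0 < #|V| /\
  exists side : V -> bool, forall x y, E x y = (x != y) && (side x == side y).
Proof.
case=> C [/and3P[/eqP cov triv C0] /eqP /cards2P[A [B [AB eC]]] EP].
have AC : A \in C by rewrite eC set21.
have BC : B \in C by rewrite eC set22.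
have dAB : [disjoint A & B] by move/trivIsetP: triv; apply.
split.
  have [A0|[x _]] := set_0Vmem A; first by rewrite -A0 AC in C0.
  by apply/card_gt0P; exists x.
have inB x : x \notin A -> x \in B.
  have : x \in cover C by rewrite cov inE.
  by case/bigcupP => D; rewrite eC => /set2P[] -> // ->.
exists (mem A) => x y; apply/idP/andP => [/EP[-> [D]]|[xy]] /=.
  rewrite eC => /set2P[] -> [xD yD]; first by rewrite xD yD.
  by rewrite !(disjointFl dAB).
move=> /eqP xAy; apply/EP; split=> //; case xA: (x \in A) xAy => yA.
  by exists A; rewrite // xA -yA.
by exists B; rewrite // !inB // -?yA ?xA.
Qed.

(** * Step count and logarithmic cost *)

(** These are the literals that [cost] charges; jump targets are free. *)
Definition operands (i : instr) : seq nat :=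
  match i with
  | Const i v => [:: i; v]
  | Add i j k | Defs.Sub i j k => [:: i; j; k]
  | LoadFrom i j | StoreTo i j => [:: i; j]
  | Read i | JumpPos i _ => [:: i]
  | Halt _ => [::]
  end.

Definition fits (L v : nat) : bool := v < 2 ^ L.

Definition config_fits (L : nat) (c : config) : Prop :=
  (forall i, fits L (Defs.mem c i)) /\ all (fits L) (inp c).

Lemma fitsW L L' v : L <= L' -> fits L v -> fits L' v.
Proof. by move=> LL vL; apply: leq_trans vL _; rewrite leq_exp2l. Qed.

Lemma bitlen_fits L v : 0 < L -> fits L v -> bitlen v <= L.
Proof.
rewrite /bitlen /fits; case: v => [|v] L0 vL; first by rewrite trunc_log0.
by rewrite -(@ltn_exp2l 2) //; apply: leq_ltn_trans vL; apply: trunc_logP.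
Qed.

Lemma fits_bitlen v : fits (bitlen v) v.
Proof. exact: trunc_log_ltn. Qed.

Lemma onth_all (T : Type) (p : pred T) s n x :
  all p s -> onth s n = Some x -> p x.
Proof.
by elim: s n => [|y s IHs] [|n] //= /andP[py ps] => [[<-]|/IHs]; last exact.
Qed.

Definition program_fits (L : nat) (P : program) : bool :=
  all (fun i => all (fits L) (operands i)) P.

Lemma program_fitsW L L' P : L <= L' -> program_fits L P -> program_fits L' P.
Proof. by move=> LL; apply: sub_all => i; apply: sub_all => v; apply: fitsW. Qed.

Lemma step_fits P L c c' :
    program_fits L P -> config_fits L c -> step P c = Some c' ->
  config_fits L.+1 c'.
Proof.
case: c => l R w PL [/= RL wL].
have up v : fits L v -> fits L.+1 v by apply: fitsW.
have wr i v : fits L.+1 v -> forall k, fits L.+1 (write R i v k).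
  by rewrite /write => vL k; case: ifP => // _; apply: up.
have hL : fits L (head 0 w) by case: w wL => [|v w] /= => [|/andP[]//]; rewrite /fits expn_gt0.
have bL : all (fits L) (behead w) by case: w wL {hL} => //= v w /andP[].
have {}wL := sub_all up wL; have {}bL := sub_all up bL.
case ei: (onth P l) => [[i v|i j k|i j k|i j|i j|i|j l'|b]|] //= [<-];
  split=> //=; try apply: wr; try exact: up; have := onth_all PL ei => /=.
- by case/and3P => _ /up.
- by have := RL j; have := RL k; rewrite /fits expnS; lia.
- by have := up _ (RL j); rewrite /fits; lia.
- by move=> _ k; apply: up.
Qed.

(** The factor 5 comes from [Add] and [Sub], which charge three indices and two contents. *)
Lemma cost_fits P L c :
  0 < L -> program_fits L P -> config_fits L c -> cost P c <= 5 * L.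
Proof.
case: c => l R w L0 PL [/= RL wL].
have hL : fits L (head 0 w) by case: w wL => [|v w] /= => [|/andP[]//]; rewrite /fits expn_gt0.
have bl v : fits L v -> bitlen v <= L by apply: bitlen_fits.
have R' i := bl _ (RL i); have {}hL := bl _ hL.
case ei: (onth P l) => [[i v|i j k|i j k|i j|i j|i|j l'|b]|] /=; last lia;
  have := onth_all PL ei => /=.
- by case/and3P => /bl ? /bl ? _; lia.
- by case/and4P => /bl ? /bl ? /bl ? _; have := R' j; have := R' k; lia.
- by case/and4P => /bl ? /bl ? /bl ? _; have := R' j; have := R' k; lia.
- by case/and3P => /bl ? /bl ? _; have := R' j; have := R' (R j); lia.
- by case/and3P => /bl ? /bl ? _; have := R' j; have := R' i; lia.
- by case/andP => /bl ? _; lia.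
- by case/andP => /bl ? _; have := R' j; lia.
- lia.
Qed.

(** An upper bound on the number of steps lets branches of different lengths share one estimate. *)
Definition reaches (P : program) (k : nat) (c : config) (Q : config -> Prop) :=
  exists j c', [/\ j <= k, iter j (obind (step P)) (Some c) = Some c' & Q c'].

Lemma reaches_now P k c (Q : config -> Prop) : Q c -> reaches P k c Q.
Proof. by move=> Qc; exists 0, c. Qed.

Lemma reaches_step P k c c' Q :
  step P c = Some c' -> reaches P k c' Q -> reaches P k.+1 c Q.
Proof.
move=> cc' [j [d [jk jd Qd]]]; exists j.+1, d; split=> //.
by rewrite iterSr /= cc'.
Qed.

Lemma leq_reaches P k k' c Q : k <= k' -> reaches P k c Q -> reaches P k' c Q.
Proof. by move=> kk [j [d [jk jd Qd]]]; exists j, d; rewrite (leq_trans jk). Qed.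

Lemma reaches_trans P k k' c Q Q' :
    reaches P k c Q -> (forall d, Q d -> reaches P k' d Q') ->
  reaches P (k + k') c Q'.
Proof.
move=> [j [d [jk jd Qd]]] /(_ d Qd) [j' [e [jk' je Qe]]].
exists (j' + j), e; split=> //; first by rewrite addnC leq_add.
by rewrite iterD jd.
Qed.

Lemma reaches_loop P k n c (Q : nat -> config -> Prop) : Q 0 c ->
    (forall i d, i < n -> Q i d -> reaches P k d (Q i.+1)) ->
  reaches P (n * k) c (Q n).
Proof.
move=> Q0; elim: n => [|n IHn] body; first exact: reaches_now.
rewrite mulSnr; apply: reaches_trans (IHn _) _ => [i d ilt|d]; apply: body => //.
exact: ltnW.
Qed.

(** Numbers gain at most one bit per step, so each of the at most [k.+1] charged instructions,
    including [Halt], costs at most [5 * (L + k)]. The induction raises [L] along the run. *)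
Lemma reaches_halts P k L c (G : bool -> Prop) : 0 < L ->
    program_fits L P -> config_fits L c ->
    reaches P k c (fun d => exists2 b, onth P (pc d) = Some (Halt b) & G b) ->
  exists b t, [/\ halts P c b t, t <= k.+1 * (5 * (L + k)) & G b].
Proof.
move=> L0 PL cL [j [d [jk jd [b Hb Gb]]]]; exists b.
suff [t ht tle] : exists2 t, halts P c b t & t <= j.+1 * (5 * (L + j)).
  exists t; split=> //; apply: leq_trans tle _.
  by rewrite leq_mul // leq_mul // leq_add2l.
elim: j c L L0 PL cL jd {jk} => [|j IHj] c L L0 PL cL.
  move=> [cd]; exists (cost P c); first by apply: halts_now; rewrite cd.
  by rewrite mul1n addn0; apply: cost_fits.
rewrite iterSr /=; case cc': (step P c) => [c'|] /=; last by rewrite iter_fix.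
case/(IHj c' L.+1) => // [||t ht tle]; first exact: program_fitsW PL.
  exact: step_fits cc'.
exists (cost P c + t); first exact: halts_later cc' ht.
have := cost_fits L0 PL cL; rewrite addSnnS in tle.
by rewrite [j.+2 * _]mulSn => cle; apply: leq_add => //; lia.
Qed.

(** * The program *)

(* R_2 counts the agents still to be served and R_(16 + i) holds the utility of
   job i, replaced by 0 once the job is used.  R_0 = 0, R_1 = 1, R_3 = 16 + m,
   R_4 = eta and R_5 = 16 are constant after line 7; R_12 and R_13 point to jobs.
   Lines 9-16 read the utility rows, each overwriting the previous one; lines
   17-25 use up the jobs of utility at least eta; in lines 26-53, R_12 points
   to x, R_11 to the best y so far, R_10 is the utility of y, and R_9 that of x. *)
Definition allocation_program : program :=
  [:: Const 1 1; Read 2; JumpPos 2 4; Halt true;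
      (*  4 *) Read 3; Read 4; Const 5 16; Add 3 3 5; Add 6 2 0;
      (*  9 *) Add 12 5 0;
      (* 10 *) Read 7; StoreTo 12 7; Add 12 12 1; Defs.Sub 8 3 12; JumpPos 8 10;
      (* 15 *) Defs.Sub 6 6 1; JumpPos 6 9;
      (* 17 *) Add 12 5 0;
      (* 18 *) LoadFrom 7 12; Defs.Sub 8 4 7; JumpPos 8 23;
      (* 21 *) StoreTo 12 0; Defs.Sub 2 2 1;
      (* 23 *) Add 12 12 1; Defs.Sub 8 3 12; JumpPos 8 18;
      (* 26 *) Add 12 5 0;
      (* 27 *) LoadFrom 9 12; StoreTo 12 0; Const 11 15; Add 10 4 0; Add 13 5 0;
      (* 32 *) Read 14; LoadFrom 7 13;
      (* 34 *) Add 8 9 7; Defs.Sub 8 4 8; Add 8 8 14; JumpPos 8 43;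
      (* 38 *) Add 8 7 1; Defs.Sub 8 8 10; JumpPos 8 43;
      (* 41 *) Add 11 13 0; Add 10 7 0;
      (* 43 *) Add 13 13 1; Defs.Sub 8 3 13; JumpPos 8 32;
      (* 46 *) StoreTo 11 0;
      (* 47 *) Defs.Sub 8 4 10; Defs.Sub 8 1 8; Defs.Sub 8 1 8; Defs.Sub 2 2 8;
      (* 51 *) Add 12 12 1; Defs.Sub 8 3 12; JumpPos 8 27;
      (* 54 *) JumpPos 2 56; Halt true; Halt false].

Definition globals (m h : nat) (R : nat -> nat) : Prop :=
  [/\ R 0 = 0, R 1 = 1, R 3 = 16 + m, R 4 = h & R 5 = 16].

Ltac tick := apply: reaches_step; [reflexivity | rewrite /write /=].

(** This is the loop test as simplification leaves it, after the pointer has advanced. *)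
Lemma next_lt m i : (0 < 16 + m - (16 + i + 1)) = (i.+1 < m).
Proof. lia. Qed.

Lemma ord_ltnS m (x y : 'I_m) : y < x.+1 -> y = x \/ y < x.
Proof. by rewrite ltnS leq_eqVlt => /orP[/eqP/val_inj|]; auto. Qed.

(** * Reading the utility table *)

Section Table.

Variables (m h n : nat) (row : seq nat).
Hypotheses (m_gt0 : 0 < m) (row_size : size row = m).

Definition col_inv (r6 : nat) (rest : seq nat) (i : nat) (c : config) : Prop :=
  let: Config l R s := c in
  [/\ l = (if i < m then 10 else 15), globals m h R /\ R 12 = 16 + i,
      R 2 = n /\ R 6 = r6,
      s = drop i row ++ rest & forall j, j < i -> R (16 + j) = nth 0 row j].

(** All rows are equal, so overwriting is harmless; the table is meaningful once one row has been
    read. *)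
Definition row_inv (rest : seq nat) (a : nat) (c : config) : Prop :=
  let: Config l R s := c in
  [/\ l = (if a < n then 9 else 17), globals m h R, R 2 = n /\ R 6 = n - a,
      s = flatten (nseq (n - a) row) ++ rest
    & 0 < a -> forall j, j < m -> R (16 + j) = nth 0 row j].

Lemma col_step r6 rest i c : i < m -> col_inv r6 rest i c ->
  reaches allocation_program 5 c (col_inv r6 rest i.+1).
Proof.
case: c => l R s im [-> [gl R12] [R2 R6] -> Rrow]; rewrite im.
have dr : drop i row = nth 0 row i :: drop i.+1 row.
  by rewrite -drop_nth ?row_size.
case: (gl) => R0 R1 R3 R4 R5.
rewrite dr /=; do 5 (tick; rewrite ?R1 ?R3 ?R12 /=).
apply: reaches_now; rewrite next_lt; split=> //=.
  by split=> //; rewrite addn1 addnS.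
move=> j; rewrite ltnS leq_eqVlt => /predU1P[->|ji]; first by rewrite eqxx.
by rewrite (eqn_add2l 16) (ltn_eqF ji) Rrow.
Qed.

Lemma row_step rest a c : a < n -> row_inv rest a c ->
  reaches allocation_program (1 + (m * 5 + 2)) c (row_inv rest a.+1).
Proof.
case: c => l R s an [-> gl [R2 R6] -> _]; rewrite an.
case: (gl) => R0 R1 R3 R4 R5.
have -> : n - a = (n - a.+1).+1 by lia.
rewrite /= -catA; tick.
apply: (reaches_trans (Q := col_inv (n - a) (flatten (nseq (n - a.+1) row) ++ rest) m)).
  apply: reaches_loop => [|i d]; last exact: col_step.
  by split=> //=; rewrite ?m_gt0 ?drop0 ?R0 ?R5.
case=> {gl R0 R1 R2 R3 R4 R5 R6} {}l {}R {}s [-> [gl R12] [R2 R6] -> Rrow].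
case: (gl) => R0 R1 R3 R4 R5.
rewrite ltnn drop_oversize ?row_size //; do 2 (tick; rewrite ?R1 ?R6 /=).
have -> : n - a - 1 = n - a.+1 by lia.
by apply: reaches_now; split=> //=; rewrite subn_gt0.
Qed.

End Table.

(** * The two greedy phases *)

Section Search.

Variables (m h : nat) (E : rel 'I_m) (rest : seq nat).
Hypotheses (m_gt0 : 0 < m) (h_gt0 : 0 < h).

Definition holds (R : nat -> nat) (w : 'I_m -> nat) : Prop :=
  forall i : 'I_m, R (16 + i) = w i.

(** [G] is the original question, kept equivalent to the residual instance in memory. *)
Definition big_inv (G : Prop) (i : nat) (c : config) : Prop :=
  let: Config l R s := c in
  [/\ l = (if i < m then 18 else 26), globals m h R, R 12 = 16 + i,
      s = rest
    & exists w, [/\ holds R w, G <-> feasible E h w (R 2)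
                  & forall j : 'I_m, j < i -> w j < h]].

Lemma big_step G i c : irreflexive E -> i < m -> big_inv G i c ->
  reaches allocation_program 8 c (big_inv G i.+1).
Proof.
case: c => l R s irr im [-> gl R12 -> [w [Rw Gw wh]]]; rewrite im.
case: (gl) => R0 R1 R3 R4 R5; pose x := Ordinal im.
do 3 (tick; rewrite ?R1 ?R3 ?R4 ?R12 ?(Rw x) /=).
have next (j : 'I_m) : j < i.+1 -> j = x \/ j < i.
  exact: (@ord_ltnS m x).
case: ifP => hx.
  do 3 (tick; rewrite ?R1 ?R3 ?R12 /=).
  apply: reaches_now; rewrite next_lt; split=> //=; first by rewrite addn1 addnS.
  exists w; split=> // j /next[->|]; last exact: wh.
  by rewrite -subn_gt0.
do 5 (tick; rewrite ?R0 ?R1 ?R3 ?R12 /=).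
apply: reaches_now; rewrite next_lt; split=> //=; first by rewrite addn1 addnS.
exists (zero_on [set x] w); split=> /= [j||j /next[->|jx]].
- by rewrite (eqn_add2l 16) /zero_on in_set1 -val_eqE /= Rw.
- rewrite subn1 Gw; apply: feasible_big => //; lia.
- by rewrite /zero_on set11.
by rewrite /zero_on; case: ifP => // _; apply: wh.
Qed.

(** Row [x] of the adjacency matrix is consumed while [x] is processed, so the matrix is never
    stored. *)
Definition matrix_from (i : nat) : seq nat :=
  [seq nat_of_bool (E x y) | x <- drop i (enum 'I_m), y <- enum 'I_m].

Definition main_inv (G : Prop) (i : nat) (c : config) : Prop :=
  let: Config l R s := c in
  [/\ l = (if i < m then 27 else 54), globals m h R, R 12 = 16 + i,
      s = matrix_from i
    & exists w, [/\ holds R w, G <-> feasible E h w (R 2),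
                    forall j : 'I_m, w j < h & forall j : 'I_m, j < i -> w j = 0]].

(* Address 15 marks the absence of a partner; it then serves as a dummy cell
   for the store that removes the partner. *)
Definition best_partner (x : 'I_m) (t : nat) (w : 'I_m -> nat) (j a v : nat) : Prop :=
  let cand (y : 'I_m) := ~~ E x y && (h <= t + w y) in
  (a = 15 /\ v = h /\ forall y : 'I_m, y < j -> ~~ cand y) \/
  (exists y : 'I_m, [/\ a = 16 + y, v = w y, cand y
                      & forall z : 'I_m, z < j -> cand z -> w y <= w z]).

Definition partner_inv (x : 'I_m) (t r : nat) (w : 'I_m -> nat) (s0 : seq nat)
    (j : nat) (c : config) : Prop :=
  let: Config l R s := c in
  [/\ l = (if j < m then 32 else 46),
      globals m h R /\ R 13 = 16 + j,
      [/\ R 2 = r, R 9 = t & R 12 = 16 + x] /\ holds R w,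
      s = [seq nat_of_bool (E x y) | y <- drop j (enum 'I_m)] ++ s0
    & best_partner x t w j (R 11) (R 10)].

Lemma drop_enum_ord (x : 'I_m) : drop x (enum 'I_m) = x :: drop x.+1 (enum 'I_m).
Proof. by rewrite (drop_nth x) ?size_enum_ord // nth_ord_enum. Qed.

Lemma partner_step x t r w s0 j c : (forall y, w y < h) -> j < m ->
  partner_inv x t r w s0 j c -> reaches allocation_program 14 c (partner_inv x t r w s0 j.+1).
Proof.
case: c => l R s wh jm [-> [gl R13] [[R2 R9 R12] Rw] -> best]; rewrite jm.
case: (gl) => R0 R1 R3 R4 R5; pose y := Ordinal jm.
rewrite (drop_enum_ord y) /=.
do 6 (tick; rewrite ?R4 ?R9 ?R13 ?(Rw y) /=).
have next (z : 'I_m) : z < j.+1 -> z = y \/ z < j.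
  exact: (@ord_ltnS m y).
(* The truncated deficit plus the conflict bit is positive exactly when [y] is no candidate. *)
have candE : (0 < h - (t + w y) + E x y) = ~~ (~~ E x y && (h <= t + w y)).
  by case: (E x y); lia.
rewrite candE; case: ifP => cy.
  do 3 (tick; rewrite ?R1 ?R3 ?R13 /=).
  apply: reaches_now; rewrite next_lt; split=> //=.
    by split=> //; rewrite addn1 addnS.
  case: best => [[-> [-> no]]|[z [-> -> cz zmin]]]; [left|right].
    by split=> //; split=> // z /next[-> //|]; apply: no.
  exists z; split=> // u /next[->|]; last exact: zmin.
  by rewrite (negbTE cy).
move/negbFE: cy => cy.
do 3 (tick; rewrite ?R1 ?R3 ?R13 /=).
case: ifP => wy.
  do 3 (tick; rewrite ?R1 ?R3 ?R13 /=).
  apply: reaches_now; rewrite next_lt; split=> //=.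
    by split=> //; rewrite addn1 addnS.
  case: best wy => [[-> [-> no]]|[z [-> -> cz zmin]]] wy.
    (* The initial value [h] exceeds every utility, so the first candidate always replaces it. *)
    by have := wh y; lia.
  right; exists z; split=> // u /next[-> _|]; [lia | exact: zmin].
do 5 (tick; rewrite ?R0 ?R1 ?R3 ?R13 /=).
apply: reaches_now; rewrite next_lt; split=> //=.
  by split=> //; rewrite addn1 addnS.
right; exists y; rewrite !addn0; split=> // u /next[-> //|uj cu].
case: best wy => [[_ [-> no]]|[z [_ -> cz zmin]]] wy.
  by have := no u uj; rewrite cu.
by have := zmin u uj cu; lia.
Qed.

Variable side : 'I_m -> bool.
Hypothesis side_conflict : forall x y, E x y = (x != y) && (side x == side y).

Lemma main_step G i c : i < m -> main_inv G i c ->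
  reaches allocation_program (5 + (m * 14 + 8)) c (main_inv G i.+1).
Proof.
case: c => l R s im [-> gl R12 -> [w [Rw Gw wh w0]]]; rewrite im.
case: (gl) => R0 R1 R3 R4 R5; pose x := Ordinal im.
have next (j : 'I_m) : j < i.+1 -> j = x \/ j < i.
  exact: (@ord_ltnS m x).
do 5 (tick; rewrite ?R0 ?R4 ?R5 ?R12 ?(Rw x) /=).
rewrite /matrix_from (drop_enum_ord x) /= -/(matrix_from i.+1).
(* As [x] is not in conflict with itself, it must be cleared before the search lest it become its
   own partner. *)
pose w1 := zero_on [set x] w.
have w1x : w1 x = 0 by rewrite /w1 /zero_on set11.
have w1z z : z != x -> w1 z = w z by rewrite /w1 /zero_on in_set1 => /negbTE->.
apply: (reaches_trans (Q := partner_inv x (w x) (R 2) w1 (matrix_from i.+1) m)).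
  apply: reaches_loop => [|j d]; last first.
    by apply: partner_step => y; rewrite /w1 /zero_on; case: ifP.
  split=> //=; first by rewrite m_gt0.
  - by split=> // j; rewrite /= (eqn_add2l 16) /w1 /zero_on in_set1 -val_eqE /= Rw.
  - by rewrite drop0.
  - by left; rewrite addn0.
move: (R 2) Gw => r Gw {Rw R0 R1 R3 R4 R5 gl R12}.
case=> {}l {}R {}s [-> [gl R13] [[R2 R9 R12] Rw] -> best].
case: (gl) => R0 R1 R3 R4 R5.
rewrite ltnn drop_oversize ?size_enum_ord //=.
case: best => [[R11 [R10 no]]|[y [R11 R10 /andP[Exy hxy] ymin]]].
  do 8 (tick; rewrite ?R0 ?R1 ?R2 ?R3 ?R4 ?R10 ?R11 ?R12 /=).
  (* With no partner, [R 10] is still [h], so nothing is subtracted from the number of agents. *)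
  rewrite subnn subn0 subnn subn0; apply: reaches_now; rewrite next_lt.
  split=> //=; first by rewrite addn1 addnS.
  exists w1; split=> // [|j|j /next[->|ji]] //.
  - rewrite Gw; apply: (feasible_unmatched side_conflict) => // y yx Exy.
    by have := no y (ltn_ord y); rewrite Exy w1z // -ltnNge.
  - by rewrite /w1 /zero_on; case: ifP.
  - by rewrite /w1 /zero_on; case: ifP => // _; apply: w0.
have yx : y != x.
  by apply: contraTneq hxy => ->; rewrite w1x addn0 -ltnNge.
do 8 (tick; rewrite ?R0 ?R1 ?R2 ?R3 ?R4 ?R10 ?R11 ?R12 /=).
(* Here [1 - (1 - d)] is the indicator of [0 < d]; a partner is lighter than [h], so one agent is
   served. *)
have -> : 1 - (1 - (h - w1 y)) = 1 by rewrite w1z //; have := wh y; lia.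
apply: reaches_now; rewrite next_lt; split=> //=; first by rewrite addn1 addnS.
have w2E z : zero_on [set x; y] w z = if z == y then 0 else w1 z.
  by rewrite /w1 /zero_on in_set2 in_set1; case: (z == x); case: (z == y).
exists (zero_on [set x; y] w); split=> [j||j|j /next[->|ji]].
- by rewrite /= (eqn_add2l 16) w2E -val_eqE /= Rw.
- rewrite subn1 Gw; apply: (feasible_matched side_conflict) => //.
    by rewrite -(w1z y yx).
  move=> z zx Exz hz; rewrite -(w1z y yx) -(w1z z zx); apply: ymin => //.
  by rewrite Exz w1z.
- by rewrite /zero_on; case: ifP.
- by rewrite /zero_on set21.
- by rewrite /zero_on; case: ifP => // _; apply: w0.
Qed.

End Search.

(** * Correctness and running time *)

Lemma allocation_program_reaches (m n h : nat) (E : rel 'I_m) (u : 'I_m -> nat)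
    (side : 'I_m -> bool) :
    0 < m -> 0 < n -> 0 < h -> (forall x y, E x y = (x != y) && (side x == side y)) ->
  reaches allocation_program (8 * n * m + 46 * m * m)
    (init [:: n, m, h & flatten (nseq n [seq u x | x <- enum 'I_m]) ++ matrix_from E 0])
    (fun c => exists2 b, onth allocation_program (pc c) = Some (Halt b)
                       & b <-> feasible E h u n).
Proof.
move=> m0 n0 h0 sideE; set row := map u _.
have row_size : size row = m by rewrite size_map size_enum_ord.
have irr : irreflexive E by move=> x; rewrite sideE eqxx.
have nth_row (x : 'I_m) : nth 0 row x = u x.
  by rewrite (nth_map x) ?size_enum_ord // nth_ord_enum.
(* The summands follow the phases of the program. Since [m] is positive, [3 * n] is at most
   [3 * n * m], and [11 + 21 * m] at most [32 * m * m]. *)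
apply: (@leq_reaches _ (8 + (n * (1 + (m * 5 + 2)) + (1 + (m * 8 + (1 +
    (m * (5 + (m * 14 + 8)) + 1))))))); first by nia.
rewrite /init; do 8 (tick; rewrite ?n0 /=).
apply: (reaches_trans (Q := row_inv m h n row (matrix_from E 0) n)).
  apply: reaches_loop => [|a d]; last exact: row_step.
  by split=> //=; rewrite ?n0 ?addn0 ?subn0 // addnC.
case=> l R s [-> gl [R2 _] -> /(_ n0) Rrow]; rewrite ltnn subnn /=.
case: (gl) => R0 R1 R3 R4 R5; tick; rewrite R0 R5.
apply: (reaches_trans (Q := big_inv h E (matrix_from E 0) (feasible E h u n) m)).
  apply: reaches_loop => [|i d]; last exact: big_step.
  split=> //=; first by rewrite m0.
  by exists u; rewrite R2; split=> // i; rewrite /= Rrow.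
case=> {gl R0 R1 R2 R3 R4 R5 Rrow} l {}R {}s [-> gl R12 -> [w [Rw Gw wh]]].
case: (gl) => R0 R1 R3 R4 R5; rewrite ltnn; tick; rewrite R0 R5.
apply: (reaches_trans (Q := main_inv h E (feasible E h u n) m)).
  apply: reaches_loop => [|i d]; last exact: (main_step m0 h0 sideE).
  split=> //=; first by rewrite m0.
  by exists w; split=> // j; apply: wh.
case=> {gl R0 R1 R3 R4 R5 R12 w Rw Gw wh} l {}R {}s [-> _ _ _ [w [_ Gw _ w0]]].
rewrite ltnn; tick; apply: reaches_now => /=.
(* Every job has been used up, so only zero agents can still be served. *)
have {}Gw : feasible E h u n <-> R 2 = 0.
  by rewrite Gw; apply: feasible_gt0 => // x; apply: w0.
by case: (R 2) Gw => [|r] Gw; [exists true | exists false] => //; rewrite Gw.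
Qed.

Lemma input_size_fits w : all (fits (input_size w)) w.
Proof.
rewrite /input_size; elim: w => [|v w IHw] //=; rewrite big_cons.
rewrite (fitsW _ (fits_bitlen v)) ?leq_addr //=.
by apply: sub_all IHw => x; apply: fitsW; apply: leq_addl.
Qed.

Lemma size_input_size w : size w <= input_size w.
Proof.
rewrite /input_size -sum1_size; exact: leq_sum.
Qed.

Lemma CFFA_feasible (I : CFFA_instance) u : (forall a, utility a =1 u) ->
  CFFA I <-> feasible (@conflict I) (eta I) u (agents I).
Proof.
move=> Uu; have sumE a (S : {set _}) : \sum_(x in S) utility a x = \sum_(x in S) u x.
  by apply: eq_bigr => x _; apply: Uu.
split=> -[phi [ind hphi dis]]; exists phi; split=> //.
- by move=> a; rewrite -(sumE a).
- by move=> a b x xa; apply: contraTeq => /dis/disjointFr ->.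
- by move=> a; rewrite sumE.
move=> a b ab; rewrite disjoint_subset; apply/subsetP => x xa; rewrite inE.
by apply: contraNN ab => xb; apply/eqP; apply: dis xa xb.
Qed.

Lemma encode_uniform (I : CFFA_instance) u : (forall a, utility a =1 u) ->
  encode_CFFA I = [:: agents I, jobs I, eta I
    & flatten (nseq (agents I) [seq u x | x <- enum 'I_(jobs I)])
      ++ matrix_from (@conflict I) 0].
Proof.
move=> Uu; rewrite /encode_CFFA /matrix_from drop0 /=; congr [:: _, _, _ & _ ++ _].
rewrite (eq_map (g := fun=> [seq u x | x <- enum 'I_(jobs I)])) => [|a].
  by rewrite -[agents I in RHS]size_enum_ord; elim: (enum 'I_(agents I)) => //= a s ->.
by apply: eq_map => x; apply: Uu.
Qed.

Theorem theorem5 :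
  poly_time_solvable_on encode_CFFA
    (fun I : CFFA_instance =>
       cluster_graph_of 2 (@conflict I) /\ uniform_utilities I)
    CFFA.
Proof.
(* The literals of the program fit in 5 bits. With [46 * N] steps the cost is at most
   [(46 * N + 1) * (5 * (47 * N + 5))], hence at most [47 * N * 5 * (52 * N)] for positive [N]. *)
exists allocation_program, (47 * 5 * 52), 2 => I [/cluster2_side[m0 [side sideE]] unif].
rewrite card_ord in m0; set N := input_size _.
suff: reaches allocation_program (46 * N) (init (encode_CFFA I))
    (fun c => exists2 b, onth allocation_program (pc c) = Some (Halt b) & b <-> CFFA I).
  case/(@reaches_halts _ _ (N + 5)); first by rewrite addn_gt0 orbT.
    exact: (program_fitsW (leq_addl N 5)).
    split=> [i|]; first by rewrite /fits expn_gt0.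
    by apply: (sub_all _ (input_size_fits _)) => v; apply: fitsW; apply: leq_addr.
  move=> b [t [ht tle bG]]; exists b, t; split=> //; apply: leq_trans tle _; nia.
have sizeN : 3 + agents I * jobs I + jobs I * jobs I <= N.
  apply: leq_trans (size_input_size _).
  by rewrite /encode_CFFA !size_cat !size_allpairs !size_enum_ord /= addnA.
(* Without agents there is no common utility function to extract; the program accepts after three
   steps. *)
have [n0|n0] := posnP (agents I).
  have [s ->] : exists s, encode_CFFA I = 0 :: s.
    by exists (behead (encode_CFFA I)); rewrite -[X in X :: _]n0.
  apply: (@leq_reaches _ 3); first lia.
  do 3 tick; apply: reaches_now; exists true => //; split=> // _; rewrite /CFFA.
  by case: (I) n0 => [[|n] m u h E ? ? ?] //= _; exists (fun=> set0); split=> -[].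
pose a0 := Ordinal n0; have Uu a : utility a =1 utility a0 by apply: unif.
apply: (@leq_reaches _ (8 * agents I * jobs I + 46 * jobs I * jobs I)).
  by nia.
rewrite (encode_uniform Uu).
have [j [c [jle jc [b Hb bG]]]] := allocation_program_reaches (utility a0) m0 n0 (eta_gt0 I) sideE.
by exists j, c; split=> //; exists b => //; rewrite bG (CFFA_feasible Uu).
Qed.
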